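(* Let $0\leq \lambda<1$ and $\omega\in A_1^+$, and let $\mathcal{T}^+$ be a one-sided sublinear operator satisfying the size condition $$|\mathcal{T}^+f(x)| \le C \int_{x}^\infty\frac{|f(y)|}{y-x}\,dy \quad\text{for all } x\in\mathbb{R},$$ with a constant $C>0$ independent of $f$ and $x$. If $\mathcal{T}^+$ is bounded from $L^1(\mathbb{R})$ to $L^{1,\infty}(\mathbb{R})$, then $\mathcal{T}^+$ is bounded from $L_+^{1,\lambda}(\omega)$ to $WL_+^{1,\lambda}(\omega)$.
   Context: All functions are on $\mathbb{R}$. A weight $\omega$ is a positive function on $\mathbb{R}$. $L^1$ and $L^{1,\infty}$ are the unweighted Lebesgue and weak Lebesgue spaces. Weight class: $\omega\in A_1^+$ means $M^-\omega\le C\omega$ for some constant $C$, where $M^-f(x)=\sup_{h>0}\frac1h\int_{x-h}^x|f(y)|\,dy$. One-sided weighted Morrey spaces: for $1\le p<\infty$, $0\le\lambda<1$, $1\le\theta<\infty$, $x_0\in\mathbb{R}$, $h>0$, put $$\Phi_{\omega,\lambda,\theta}^{+}(x_0,h)=h^{\lambda-1}\int_{x_0-h}^{x_0}\omega(x)^\theta\,dx.$$ The space $L^{p,\lambda}_+(\omega^\theta)=L^{p,\lambda}_+(\mathbb{R},\omega^\theta)$ consists of the $f$ with $$\|f\|_{L^{p,\lambda}_{+}(\omega^\theta)}=\sup_{x_0\in\mathbb{R},\,h>0}\Big(\frac{1}{\Phi_{\omega,\lambda,\theta}^{+}(x_0,h)}\int_{x_0}^{x_0+h}|f(y)|^p\,dy\Big)^{1/p}<\infty,$$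 and the weak-type space $WL^{p,\lambda}_+(\omega^\theta)$ consists of the $f$ with $$\|f\|^{p}_{WL^{p,\lambda}_+(\omega^\theta)}=\sup_{x_0\in\mathbb{R},\,h>0}\frac{1}{\Phi_{\omega,\lambda,\theta}^{+}(x_0,h)}\sup_{\gamma>0}\gamma^p\big|\{x\in(x_0,x_0+h):|f(x)|>\gamma\}\big|<\infty.$$ Here $L^{1,\lambda}_+(\omega)$ and $WL^{1,\lambda}_+(\omega)$ are the cases $p=1$, $\theta=1$. An operator $\mathcal T$ is bounded between two such spaces if the norm of $\mathcal Tf$ in the target is at most a constant times the norm of $f$ in the source. *)

(* Defs.v *)
From HB Require Import structures.
From mathcomp Require Import all_boot all_order all_algebra.
From mathcomp Require Import all_classical all_reals all_analysis.
From mathcomp Require Import measurable_realfun.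
Import Order.TTheory GRing.Theory Num.Theory.
Import numFieldNormedType.Exports.

Set Implicit Arguments.
Unset Strict Implicit.
Unset Printing Implicit Defensive.

Local Open Scope classical_set_scope.
Local Open Scope ring_scope.
Local Open Scope ereal_scope.

Section defs.
Context {R : realType}.
Local Notation mu := (@lebesgue_measure R).
Implicit Types (f w : R -> R) (g : R -> \bar R) (x h p lambda theta : R).

Definition weight w := measurable_fun [set: R] w /\ forall x, (0 < w x)%R.

(* one-sided Hardy-Littlewood maximal function M^- *)
Definition maximal_minus f x : \bar R :=
  ereal_sup [set (h^-1)%:E * \int[mu]_(y in `[(x - h)%R, x]) `|f y|%:E
            | h in [set h : R | (0 < h)%R]].

(* The A_1^+ inequality is between functions defined up to null sets, hence
   holds almost everywhere. *)
Definition A1plus w :=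
  exists C : R, {ae mu, forall x, maximal_minus w x <= (C * w x)%:E}.

Definition L1 : set (R -> R) := [set f | f \in Lfun mu 1].

Definition L1_norm f : \bar R := 'N[mu]_1[EFin \o f].

Definition Phi_plus w lambda theta x0 h : \bar R :=
  (h `^ (lambda - 1))%:E * \int[mu]_(x in `[(x0 - h)%R, x0]) (w x `^ theta)%:E.

Definition morrey_norm p lambda theta w f : \bar R :=
  ereal_sup
    [set ((Phi_plus w lambda theta x0 h)^-1 *
          \int[mu]_(y in `[x0, (x0 + h)%R]) (`|f y| `^ p)%:E) `^ (p^-1)
    | x0 in [set: R] & h in [set h : R | (0 < h)%R]].

Definition morrey p lambda theta w : set (R -> R) :=
  [set f | measurable_fun [set: R] f /\ morrey_norm p lambda theta w f < +oo].

(* p-th power of the weak L^p quasi-norm on A *)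
Definition weak_Lpow p (A : set R) g : \bar R :=
  ereal_sup [set (gamma `^ p)%:E * mu (A `&` [set x | gamma%:E < `|g x|])
            | gamma in [set gamma : R | (0 < gamma)%R]].

Definition weak_Lnorm p g : \bar R := weak_Lpow p [set: R] g `^ (p^-1).

Definition weak_morrey_norm p lambda theta w g : \bar R :=
  ereal_sup
    [set (Phi_plus w lambda theta x0 h)^-1 *
         weak_Lpow p `]x0, (x0 + h)%R[ g
    | x0 in [set: R] & h in [set h : R | (0 < h)%R]] `^ (p^-1).

(* T is an operator with domain D; its values on functions outside D are junk
   and are never used.  Tf is allowed to take infinite values, as a maximal
   function may. *)
Record sublinear_operator (D : set (R -> R)) (T : (R -> R) -> R -> \bar R) :
    Prop := SublinearOperator {
  sublin_dom_measurable : forall f, D f -> measurable_fun [set: R] f ;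
  sublin_dom0 : D (cst 0%R) ;
  sublin_domD : forall f1 f2, D f1 -> D f2 -> D (f1 \+ f2)%R ;
  sublin_domZ : forall (a : R) f, D f -> D (fun x => a * f x)%R ;
  sublin_measurable : forall f, D f -> measurable_fun [set: R] (T f) ;
  sublin_subadditive : forall f1 f2, D f1 -> D f2 ->
    {ae mu, forall x, `|T (f1 \+ f2)%R x| <= `|T f1 x| + `|T f2 x|} ;
  sublin_homogeneous : forall (a : R) f, D f ->
    {ae mu, forall x, `|T (fun y => a * f y)%R x| = `|a|%:E * `|T f x|} }.

Definition size_condition_plus (D : set (R -> R))
    (T : (R -> R) -> R -> \bar R) (C : R) :=
  forall f, D f -> forall x,
    `|T f x| <= C%:E * \int[mu]_(y in `]x, +oo[) (`|f y| / (y - x))%:E.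

Definition bounded_operator (X : set (R -> R)) (normX : (R -> R) -> \bar R)
    (normY : (R -> \bar R) -> \bar R) (T : (R -> R) -> R -> \bar R) :=
  exists2 C : R, (0 < C)%R & forall f, X f -> normY (T f) <= C%:E * normX f.

End defs.

(* Main.v *)
Require Import Defs.
From mathcomp Require Import all_boot all_order all_algebra.
From mathcomp Require Import all_classical all_reals all_analysis.
From mathcomp Require Import measurable_realfun.
From mathcomp Require Import ring lra.
Import Order.TTheory GRing.Theory Num.Theory.
Import numFieldNormedType.Exports.

(** Fix x0 and h and write Phi(s) for the weight quantity of the Morrey norm
    at the point x0 and scale s, N for the Morrey norm of f.  Split f into a
    part near x0 and a remainder: let f1 be f on [x0, x0 + 2h] and 0 elsewhere, g = f - f1.

    Everything rests on how Phi grows with the scale.  The A_1^+ condition says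
    that the mass of w on [x - s, x] is at most A s w(x) for almost every x.
    Take s = kh: for x in [x0 - h, x0], the interval [x - kh, x] contains
    [x0 - kh, x0 - h[, so averaging this bound over such x controls the far
    mass by k A times the mass on [x0 - h, x0] (left_mass_dilate).  Multiplied
    by the factor h^(lambda - 1), this gives
    Phi(kh) <= k^lambda (1 + A) Phi(h) for k >= 1 (Phi_plus_dilate).

    Near part: the weak (1,1) bound controls T f1 by the L^1 norm of f1, which
    is at most N Phi(2h), hence at most a constant times N Phi(h).

    Far part: for x in ]x0, x0 + h[ the size condition only sees g beyond
    x0 + 2h.  On the shell 2^(j+1) h < y - x0 <= 2^(j+2) h one has
    y - x >= 2^j h, and the integral of |f| there is at most
    N Phi(2^(j+2) h) <= 4^lambda (2^lambda)^j (1 + A) N Phi(h).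
    Summing over j is a geometric series of ratio 2^lambda / 2, and
    2^lambda < 2 is where lambda < 1 enters (tail_kernel_integral_le).
    So |T g| is bounded on ]x0, x0 + h[ by a constant times N Phi(h) / h,
    and its weak L^1 quasi-norm there by a constant times N Phi(h).
    Sublinearity adds the two parts up (weak_Lpow1_le_add). *)

Local Open Scope classical_set_scope.
Local Open Scope ring_scope.

Set Implicit Arguments.
Unset Strict Implicit.

(** * Mass of a one-sided weight to the left of a point *)

Lemma ae_exists_itv (R : realType) (P : R -> Prop) (a b : R) :
  a < b -> {ae @lebesgue_measure R, forall x, P x} ->
  exists2 x, x \in `]a, b[ & P x.
Proof.
move=> ab [N [mN N0 PN]]; apply: contrapT => noP.
have abN : `]a, b[%classic `<=` N.
  by move=> x xab; apply: PN => /= Px; apply: noP; exists x.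
have : (lebesgue_measure `]a, b[%classic <= lebesgue_measure N)%E.
  by apply: le_measure; rewrite ?inE.
rewrite N0 lebesgue_measure_itv/= lte_fin ab -EFinB lee_fin; lra.
Qed.

Section one_sided_weight.
Variables (R : realType) (w : R -> R).
Hypothesis w_weight : weight w.
Local Notation mu := (@lebesgue_measure R).

Definition left_mass (x h : R) : \bar R := \int[mu]_(y in `[x - h, x]) (w y)%:E.

Let w_ge0 x : 0 <= w x.
Proof. by rewrite ltW//; apply w_weight. Qed.

Let measurable_w (D : set R) : measurable_fun D (EFin \o w).
Proof.
apply/measurable_EFinP; apply: measurable_funTS; exact: w_weight.1.
Qed.

Let w_integral_subset (A B : set R) : measurable A -> measurable B ->
  A `<=` B -> (\int[mu]_(y in A) (w y)%:E <= \int[mu]_(y in B) (w y)%:E)%E.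
Proof.
move=> mA mB AB; apply: ge0_subset_integral => //; first exact: measurable_w.
by move=> y _; rewrite lee_fin.
Qed.

Lemma left_mass_ge0 x h : (0 <= left_mass x h)%E.
Proof. by apply: integral_ge0 => y _; rewrite lee_fin. Qed.

Lemma left_mass_gt0 x h : 0 < h -> (0 < left_mass x h)%E.
Proof.
move=> h0; rewrite lt0e left_mass_ge0 andbT; apply/eqP => W0.
have mI : measurable (`[x - h, x]%classic : set R) by exact: measurable_itv.
have : (\int[mu]_(y in `[(x - h)%R, x]) `|(EFin \o w) y|)%E = 0%E.
  by rewrite -W0; apply: eq_integral => y _ /=; rewrite ger0_norm.
move=> /(ae_eq_integral_abs mu mI (@measurable_w _)).1.
move=> /(@ae_exists_itv _ _ (x - h)%R x)[|y]; first lra.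
rewrite in_itv/= => /andP[/ltW xy /ltW yx].
rewrite /= in_itv/= xy yx => /(_ isT)[] /eqP; apply/negP.
by rewrite gt_eqF//; apply w_weight.
Qed.

(** The constant of A_1^+ is replaced by its maximum with 0, so that later
    estimates may multiply by it without losing monotonicity. *)
Lemma A1plus_left_mass : A1plus w -> exists2 A : R, 0 <= A &
  {ae mu, forall x, forall h, 0 < h -> (left_mass x h <= (h * A * w x)%:E)%E}.
Proof.
case=> A wA; exists (Num.max 0 A); first by rewrite le_max lexx.
apply: (@filterS _ _ (ae_filter_ringOfSetsType mu)) wA => x Mx h h0.
rewrite -mulrA EFinM -lee_pdivrMl//.
apply: (@le_trans _ _ (A * w x)%:E); last first.
  by rewrite lee_fin ler_wpM2r// le_max lexx orbT.
apply: le_trans Mx; apply: ereal_sup_ubound; exists h => //.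
congr (_ * _)%E; apply: eq_integral => y _; by rewrite ger0_norm.
Qed.

Section dilate.
Variable A : R.
Hypothesis A_ge0 : 0 <= A.
Hypothesis wA :
  {ae mu, forall x, forall h, 0 < h -> (left_mass x h <= (h * A * w x)%:E)%E}.

(** The A_1^+ bound is finite at almost every point, hence at some z slightly to
    the right of x, and a left interval of z contains the given one of x.  So an
    A_1^+ weight is locally integrable. *)
Lemma left_mass_lty x h : 0 < h -> (left_mass x h < +oo)%E.
Proof.
move=> h0; have [|z] := @ae_exists_itv _ _ x (x + 1) _ wA; first lra.
rewrite in_itv/= => /andP[xz _] /(_ (h + (z - x))) Hz.
apply: (@le_lt_trans _ _ (left_mass z (h + (z - x)))).
  apply: w_integral_subset => //.
  by apply: subset_itv; rewrite bnd_simp; lra.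
by apply: le_lt_trans (ltry _); apply: Hz; lra.
Qed.

(** For every y in [x - h, x], the interval [x - kh, x - h[ lies in [y - kh, y], so
    the mass of the far interval is at most k h A w(y) for almost every such y;
    integrating over y turns w(y) into the near mass. *)
Lemma left_mass_dilate x h k : 0 < h -> 1 <= k ->
  (left_mass x (k * h) <= (1 + k * A)%:E * left_mass x h)%E.
Proof.
move=> h0 k1.
have kh : h <= k * h by rewrite ler_peMl// ltW.
have split_itv : `[x - k * h, x]%classic =
    `[x - k * h, x - h[%classic `|` `[x - h, x]%classic.
  by apply: itv_bndbnd_setU; rewrite bnd_simp; lra.
rewrite /left_mass split_itv ge0_integral_setU//; last 3 first.
- exact: measurable_w.
- by move=> y _; rewrite lee_fin.
- rewrite disj_set2E; apply/eqP/seteqP; split => // y [] /=.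
  rewrite !in_itv/=; lra.
set W := (X in (X + _ <= _)%E).
have W0 : (0 <= W)%E by apply: integral_ge0 => y _; rewrite lee_fin.
(* W is constant in y: this is the averaging step. *)
have : (\int[mu]_(y in `[(x - h)%R, x]) W <=
        \int[mu]_(y in `[(x - h)%R, x]) ((k * h * A)%:E * (w y)%:E))%E.
  apply: ae_ge0_le_integral => //.
  - by move=> y _; rewrite -EFinM lee_fin !mulr_ge0//; lra.
  - by apply: measurable_funeM; exact: measurable_w.
  - apply: (@filterS _ _ (ae_filter_ringOfSetsType mu)) wA => y wy.
    rewrite /= in_itv/= => yx.
    rewrite -EFinM; apply: le_trans (wy (k * h) _); last lra.
    apply: w_integral_subset => //.
    by apply: subset_itv; rewrite bnd_simp; lra.
have mu_itv : mu `[x - h, x]%classic = h%:E.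
  rewrite lebesgue_measure_itv/= lte_fin ifT; last lra.
  by rewrite -EFinB opprB addrC subrK.
have -> : (\int[mu]_(y in `[(x - h)%R, x]) W = W * h%:E)%E.
  by rewrite (integral_cst mu (measurable_itv `[x - h, x]) W) -mu_itv.
rewrite ge0_integralZl//; last 3 first.
- exact: measurable_w.
- by move=> y _; rewrite lee_fin.
- by rewrite lee_fin !mulr_ge0//; lra.
rewrite muleC -mulrA mulrCA EFinM -muleA.
rewrite lee_pmul2l// ?lte_fin// => Wle.
by rewrite EFinD ge0_muleDl ?lee_fin ?mulr_ge0 ?mul1e 1?addeC ?leeD2l//; lra.
Qed.

End dilate.
End one_sided_weight.

(** * The kernel 1 / (y - x) far from x *)

Lemma dyadic_shell (R : realType) (t : R) : 2 < t ->
  exists j, 2 ^+ j.+1 < t <= 2 ^+ j.+2.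
Proof.
move=> t2.
have ex : exists n, t <= 2 ^+ n.
  by exists (Num.Def.archi_bound t); rewrite ltW// upper_nthrootP.
case: (ex_minnP ex) => -[|[|j]] tj minj.
- by rewrite expr0 in tj; lra.
- by rewrite expr1 in tj; lra.
exists j; rewrite tj andbT ltNge; apply/negP => /minj.
by rewrite ltnn.
Qed.

Lemma nneseries_geometric_le (R : realType) (u : nat -> \bar R) (a q : R) :
  0 <= a -> 0 < q < 1 -> (forall j, 0 <= u j <= (a * q ^+ j)%:E)%E ->
  (\sum_(0 <= j <oo) u j <= (a / (1 - q))%:E)%E.
Proof.
move=> a0 /andP[q0 q1] u_aq; apply: lime_le.
  by apply: is_cvg_nneseries => j _ _; case/andP: (u_aq j).
apply: nearW => n.
apply: (@le_trans _ _ (series (geometric a q) n)%:E); last first.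
  by rewrite lee_fin geometric_le_lim// ger0_norm// ltW.
rewrite /series/= -sumEFin; apply: lee_sum => j _.
by case/andP: (u_aq j).
Qed.

(** On the shell 2^(j+1) h < y - x0 <= 2^(j+2) h the distance y - x is at least
    2^(j+1) h - h >= 2^j h, so the kernel is at most 1 / (2^j h).  Growth of the
    integrals of |f| at a rate r < 2 is beaten by this decay.  The integrand is
    dominated by the sum over j of |f| / (2^j h) on all of
    [x0, x0 + 2^(j+2) h] rather than on the shells alone: this costs nothing,
    since the integrals of |f| are known on these larger intervals. *)
Lemma tail_kernel_integral_le (R : realType) (f g : R -> R) (x0 h x a r : R) :
  let mu := @lebesgue_measure R in
  measurable_fun setT f -> measurable_fun setT g ->
  0 < h -> x < x0 + h -> 0 <= a -> 0 < r < 2 ->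
  (forall y, x < y -> `|g y| <= `|f y|) ->
  (forall y, x < y <= x0 + 2 * h -> g y = 0) ->
  (forall j : nat, \int[mu]_(y in `[x0, (x0 + 2 ^+ j.+2 * h)%R]) (`|f y|)%:E <=
    (a * r ^+ j)%:E)%E ->
  (\int[mu]_(y in `]x, +oo[) (`|g y| / (y - x))%:E <=
    (a / h / (1 - r / 2))%:E)%E.
Proof.
move=> mu mf mg h0 xh a0 r2 gf g0 intf.
pose I j := `[x0, x0 + 2 ^+ j.+2 * h]%classic.
pose F j (y : R) : \bar R := ((2 ^+ j * h)^-1%:E * `|f y|%:E)%E.
have c0 j : 0 < 2 ^+ j * h by rewrite mulr_gt0// exprn_gt0.
have F0 j y : (0 <= F j y)%E.
  by rewrite /F -EFinM lee_fin mulr_ge0// invr_ge0 ltW.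
have FI0 j y : (0 <= (F j \_ (I j)) y)%E by apply: erestrict_ge0.
have mf' (D : set R) : measurable_fun D (fun y => `|f y|%:E).
  apply/measurable_EFinP/measurableT_comp => //; exact: measurable_funTS.
have mF (D : set R) j : measurable_fun D (F j) by exact: measurable_funeM.
have mFI j : measurable_fun setT (F j \_ (I j)).
  by apply: (measurable_restrictT (F j) (measurable_itv _)).1.
apply: (@le_trans _ _ (\int[mu]_(y in `]x, +oo[) \sum_(0 <= j <oo) (F j \_ (I j)) y)%E).
  apply: ge0_le_integral => //.
  - move=> y; rewrite /= in_itv/= andbT => xy.
    by rewrite lee_fin divr_ge0//; lra.
  - apply/measurable_EFinP; apply: measurable_funM.
      by apply/measurableT_comp => //; exact: measurable_funTS.
    apply: open_continuous_measurable_fun; first exact: interval_open.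
    move=> y; rewrite inE/= in_itv/= andbT => xy.
    apply: (@continuousV R R (fun z => z - x)); first by rewrite subr_eq0 gt_eqF.
    by apply: (@continuousB R R R id (cst x)) => //; exact: cvg_cst.
  - apply: ge0_emeasurable_sum => j *; first exact: FI0.
    by apply: measurable_funTS; exact: mFI.
  move=> y; rewrite /= in_itv/= andbT => xy.
  have [yx0|yx0] := leP y (x0 + 2 * h).
    by rewrite g0 ?xy// normr0 mul0r; apply: nneseries_ge0 => *; apply: FI0.
  have [|j] := @dyadic_shell _ ((y - x0) / h).
    by rewrite ltr_pdivlMr//; lra.
  rewrite ltr_pdivlMr// ler_pdivrMr// => /andP[yj1 yj2].
  apply: le_trans (nneseries_lim_ge j.+1 _) => //.
  rewrite big_nat_recr//=.
  apply: (@le_trans _ _ ((F j \_ (I j)) y)); last first.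
    by rewrite leeDr//; apply: sume_ge0.
  rewrite patchE ifT; last by rewrite inE /I/= in_itv/=; lra.
  rewrite /F -EFinM lee_fin mulrC.
  apply: ler_pM => //; last exact: gf.
    by rewrite invr_ge0; lra.
  have hj : h <= 2 ^+ j * h by rewrite ler_peMl ?exprn_ege1 ?ltW//; lra.
  rewrite lef_pV2 ?posrE//; last lra.
  by rewrite exprS -mulrA in yj1; lra.
rewrite integral_nneseries//; last first.
  by move=> j; apply: measurable_funTS; exact: mFI.
apply: nneseries_geometric_le; [by rewrite divr_ge0// ltW|lra|move=> j].
rewrite integral_ge0//=.
rewrite -integral_mkcondr.
apply: (@le_trans _ _ (\int[mu]_(y in I j) F j y)%E).
  apply: ge0_subset_integral => //.
  - by apply: measurableI; exact: measurable_itv.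
  - exact: measurable_itv.
  - exact: mF.
rewrite ge0_integralZl//; last 3 first.
- exact: measurable_itv.
- exact: mf'.
- by rewrite lee_fin invr_ge0 ltW.
rewrite lee_pdivrMl//; apply: (le_trans (intf j)).
rewrite -EFinM lee_fin.
have -> : 2 ^+ j * h * (a / h * (r / 2) ^+ j) = a * r ^+ j; last by [].
have cj0 : (2 : R) ^+ j != 0 by rewrite expf_neq0.
by rewrite expr_div_n; field; rewrite cj0 gt_eqF.
Qed.

(** * Scaling of the Morrey weight *)

Section morrey_scale.
Variables (R : realType) (w : R -> R) (lambda A : R).
Hypothesis w_weight : weight w.
Hypothesis A_ge0 : 0 <= A.
Local Notation mu := (@lebesgue_measure R).
Hypothesis wA :
  {ae mu, forall x, forall h, 0 < h -> (left_mass w x h <= (h * A * w x)%:E)%E}.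

Lemma Phi_plus_left_mass x h :
  Phi_plus w lambda 1 x h = ((h `^ (lambda - 1))%:E * left_mass w x h)%E.
Proof.
congr (_ * _)%E; apply: eq_integral => y _.
by rewrite powRr1// ltW//; apply w_weight.
Qed.

(** Both bounds matter for the inverse of Phi_plus in the Morrey norm: at +oo the
    inverse is 0 and the norm would say nothing about f, at 0 it is +oo. *)
Lemma Phi_plus_EFin x h : 0 < h ->
  exists2 p, 0 < p & Phi_plus w lambda 1 x h = p%:E.
Proof.
move=> h0; rewrite Phi_plus_left_mass.
have := left_mass_lty w_weight wA x h0.
have := left_mass_gt0 w_weight x h0.
case: left_mass => // m; rewrite lte_fin => m0 _.
by exists (h `^ (lambda - 1) * m) => //; rewrite mulr_gt0// powR_gt0.
Qed.

(** The mass grows by at most 1 + kA <= k (1 + A), and the power of the scale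
    contributes k^(lambda - 1). *)
Lemma Phi_plus_dilate x h k : 0 < h -> 1 <= k ->
  (Phi_plus w lambda 1 x (k * h) <=
   (k `^ lambda * (1 + A))%:E * Phi_plus w lambda 1 x h)%E.
Proof.
move=> h0 k1; rewrite !Phi_plus_left_mass.
have k0 : 0 < k by lra.
apply: (@le_trans _ _ (((k * h) `^ (lambda - 1))%:E *
    ((1 + k * A)%:E * left_mass w x h))%E).
  rewrite lee_pmul2l// ?lte_fin ?powR_gt0 ?mulr_gt0//.
  exact: left_mass_dilate.
rewrite !muleA -!EFinM; apply: lee_wpmul2r; first exact: left_mass_ge0.
rewrite lee_fin (powRM _ (ltW k0) (ltW h0)) mulrAC ler_wpM2r ?powR_ge0//.
have -> : k `^ lambda = k `^ (lambda - 1) * k.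
  rewrite -[X in _ = _ * X](powRr1 (ltW k0)) -powRD; first by rewrite subrK.
  by rewrite (gt_eqF k0) implybT.
rewrite -mulrA ler_wpM2l ?powR_ge0//; lra.
Qed.

End morrey_scale.

Lemma morrey_integral_le (R : realType) (lambda : R) (w f : R -> R) (x h p : R) :
  0 < h -> 0 < p -> Phi_plus w lambda 1 x h = p%:E ->
  (\int[@lebesgue_measure R]_(y in `[x, (x + h)%R]) (`|f y|)%:E <=
    p%:E * morrey_norm 1 lambda 1 w f)%E.
Proof.
move=> h0 p0 Phip; rewrite -lee_pdivrMl//.
apply: ereal_sup_ubound; exists x => //; exists h => //.
rewrite Phip inver gt_eqF// invr1 poweRe1; last first.
  apply: mule_ge0; first by rewrite lee_fin invr_ge0 ltW.
  by apply: integral_ge0 => y _; rewrite lee_fin powR_ge0.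
by congr (_ * _)%E; apply: eq_integral => y _; rewrite powRr1.
Qed.

(** * Splitting a function and its weak norm *)

Lemma restrict_L1 (R : realType) (f : R -> R) (I : set R) :
  measurable I -> measurable_fun setT f ->
  (\int[@lebesgue_measure R]_(y in I) (`|f y|)%:E < +oo)%E -> L1 (f \_ I).
Proof.
move=> mI mf fI; apply/Lfun1_integrable.
have -> : EFin \o (f \_ I) = (EFin \o f) \_ I.
  by apply/funext => y; rewrite /= !patchE; case: ifP.
apply: (integrable_mkcond (mu := @lebesgue_measure R) _ _).1; first exact: mI.
apply/integrableP; split => //.
by apply/measurable_EFinP; exact: measurable_funTS.
Qed.

Lemma L1_norm_restrict (R : realType) (f : R -> R) (I : set R) :
  L1_norm (f \_ I) = (\int[@lebesgue_measure R]_(y in I) (`|f y|)%:E)%E.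
Proof.
rewrite /L1_norm Lnorm1 [RHS]integral_mkcond; apply: eq_integral => y _.
by rewrite /= !patchE; case: ifP => // _; rewrite normr0.
Qed.

Lemma weak_Lpow_ge0 (R : realType) (p : R) (I : set R) (g : R -> \bar R) :
  (0 <= weak_Lpow p I g)%E.
Proof.
apply: (@le_trans _ _ ((1 `^ p)%:E * (@lebesgue_measure R)
  (I `&` [set x | (1%:E < `|g x|)%E]))%E).
  by rewrite mule_ge0// lee_fin powR_ge0.
by apply: ereal_sup_ubound; exists 1 => //=.
Qed.

Lemma weak_Lnorm1E (R : realType) (g : R -> \bar R) :
  weak_Lnorm 1 g = weak_Lpow 1 setT g.
Proof. by rewrite /weak_Lnorm invr1 poweRe1// weak_Lpow_ge0. Qed.

Lemma weak_morrey_norm1_le (R : realType) (lambda : R) (w : R -> R)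
    (g : R -> \bar R) (M : \bar R) :
  (forall x h : R, 0 < h -> (0 <= Phi_plus w lambda 1 x h)%E) ->
  (forall x h : R, 0 < h -> ((Phi_plus w lambda 1 x h)^-1 *
    weak_Lpow 1 `]x, (x + h)%R[%classic g <= M)%E) ->
  (weak_morrey_norm 1 lambda 1 w g <= M)%E.
Proof.
move=> Phi0 gM; rewrite /weak_morrey_norm invr1 poweRe1; last first.
  apply: le_trans (ereal_sup_ubound _); last first.
    by exists 0 => //; exists 1 => //=.
  by apply: mule_ge0; [rewrite inve_ge0 Phi0|exact: weak_Lpow_ge0].
by apply: ge_ereal_sup => _ [x _ [h h0 <-]]; exact: gM.
Qed.

Lemma morrey_norm_ge0 (R : realType) (p lambda theta : R) (w f : R -> R) :
  (0 <= morrey_norm p lambda theta w f)%E.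
Proof.
apply: le_trans (ereal_sup_ubound _); last first.
  by exists 0 => //; exists 1 => //=.
exact: poweR_ge0.
Qed.

(** Where |g| > gamma, one of the two terms exceeds gamma / 2.  If
    gamma > 2 M it cannot be the bounded one, so only the level set of g1
    counts; if gamma <= 2 M the trivial bound by the length of the interval is
    enough. *)
Lemma weak_Lpow1_le_add (R : realType) (g g1 g2 : R -> \bar R) (a b M : R) :
  a < b -> 0 <= M ->
  measurable_fun setT g -> measurable_fun setT g1 ->
  {ae @lebesgue_measure R, forall x, (`|g x| <= `|g1 x| + `|g2 x|)%E} ->
  (forall x, x \in `]a, b[ -> (`|g2 x| <= M%:E)%E) ->
  (weak_Lpow 1 `]a, b[ g <=
    2%:E * weak_Lpow 1 setT g1 + (2 * M * (b - a))%:E)%E.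
Proof.
move=> ab M0 mg mg1 [N [mN N0 gN]] g2M; apply: ge_ereal_sup => _ [gamma gamma0 <-].
have mu0 X : (0 <= (@lebesgue_measure R) X)%E by exact: measure_ge0.
have W0 := weak_Lpow_ge0 1 setT g1.
have mlev (k : R -> \bar R) (c : R) : measurable_fun setT k ->
    measurable (setT `&` [set x | (c%:E < `|k x|)%E]).
  by move=> mk; apply: emeasurable_fun_o_infty => //; exact: measurableT_comp.
rewrite (powRr1 (ltW gamma0)).
have muab : (@lebesgue_measure R) `]a, b[%classic = (b - a)%:E.
  by rewrite lebesgue_measure_itv/= lte_fin ab -EFinB.
have [gammaM|Mgamma] := leP gamma (2 * M).
  rewrite -[leLHS]add0e; apply: leeD; first by rewrite mule_ge0.
  rewrite EFinM -muab; apply: lee_pmul => //.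
  - by rewrite lee_fin ltW.
  - apply: le_measure; rewrite ?inE//.
    by apply: measurableI => //; rewrite -[X in measurable X]setTI; exact: mlev.
apply: (@le_trans _ _ (gamma%:E * (@lebesgue_measure R)
    (N `|` (setT `&` [set x | ((gamma / 2)%:E < `|g1 x|)%E])))%E).
  apply: lee_wpmul2l; first by rewrite lee_fin ltW.
  apply: le_measure; rewrite ?inE.
  - by apply: measurableI => //; rewrite -[X in measurable X]setTI; exact: mlev.
  - by apply: measurableU => //; exact: mlev.
  move=> x [xab /= gx].
  have [Nx|Nx] := pselect (N x); [by left|right; split => //=].
  have gle : (`|g x| <= `|g1 x| + `|g2 x|)%E.
    by apply: contrapT => gx12; apply: Nx; exact: gN.
  rewrite ltNge; apply/negP => g1x; move: gx; apply/negP; rewrite -leNgt.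
  apply: (le_trans gle); apply: (le_trans (leeD g1x (g2M _ xab))).
  by rewrite -EFinD lee_fin; lra.
apply: (@le_trans _ _ (2%:E * weak_Lpow 1 setT g1)%E); last first.
  by rewrite leeDl// lee_fin !mulr_ge0//; lra.
have -> : gamma%:E = (2%:E * (gamma / 2)%:E)%E by rewrite -EFinM; congr EFin; field.
rewrite -muleA; apply: lee_wpmul2l => //.
apply: (@le_trans _ _ ((gamma / 2)%:E * (@lebesgue_measure R)
    (setT `&` [set x | ((gamma / 2)%:E < `|g1 x|)%E]))%E).
  apply: lee_wpmul2l; first by rewrite lee_fin; lra.
  apply: (le_trans (measureU2 _ mN (mlev _ _ mg1))).
  by rewrite [X in (X + _)%E](_ : _ = 0%E) ?add0e.
apply: ereal_sup_ubound; exists (gamma / 2); first by rewrite /= divr_gt0.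
by rewrite powRr1// ltW// divr_gt0.
Qed.

Unset Implicit Arguments.
Set Strict Implicit.

Theorem theorem2p1 (R : realType) (lambda : R) (w : R -> R)
    (D : set (R -> R)) (T : (R -> R) -> R -> \bar R) (C : R)
    (lambda_ge0 : 0 <= lambda) (lambda_lt1 : lambda < 1)
    (w_weight : weight w) (w_A1plus : A1plus w)
    (D_L1 : L1 `<=` D)
    (D_morrey : morrey 1 lambda 1 w `<=` D)
    (T_sublinear : sublinear_operator D T)
    (C_gt0 : 0 < C) (T_size : size_condition_plus D T C)
    (T_weak11 : bounded_operator L1 L1_norm (weak_Lnorm 1) T) :
  bounded_operator (morrey 1 lambda 1 w) (morrey_norm 1 lambda 1 w)
    (weak_morrey_norm 1 lambda 1 w) T.
Proof.
have [A A0 wA] := A1plus_left_mass w_weight w_A1plus.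
have [B B0 TB] := T_weak11.
pose r : R := 2 `^ lambda.
have r0 : 0 < r by rewrite powR_gt0.
have r2 : r < 2.
  rewrite /r /powR pnatr_eq0/= -[ltRHS]lnK ?posrE// ltr_expR gtr_pMl//.
  by rewrite ln_gt0// ltr1n.
(* The two terms are the contributions of the near and of the far part. *)
pose K : R := 2 * B * (r * (1 + A)) + 2 * (C * (r ^+ 2 * (1 + A) / (1 - r / 2))).
have A1 : 0 < 1 + A by lra.
have K0 : 0 < K.
  rewrite /K addr_gt0// !mulr_gt0// ?invr_gt0; lra.
exists K => // f fM; have [mf f_lty] := fM.
have := morrey_norm_ge0 1 lambda 1 w f.
have intf x0 h p := @morrey_integral_le R lambda w f x0 h p.
move: f_lty intf; case: (morrey_norm 1 lambda 1 w f) => // n _ intf.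
rewrite lee_fin => n0.
have Phi_fin x h := @Phi_plus_EFin _ _ lambda _ w_weight wA x h.
apply: weak_morrey_norm1_le => [x0 h h0|x0 h h0].
  by have [p /ltW p0 ->] := Phi_fin x0 h h0; rewrite lee_fin.
have [p p0 Phip] := Phi_fin x0 h h0.
(* Morrey control of f on a dilated interval, expressed at the scale h. *)
have intk k : 1 <= k -> (\int[@lebesgue_measure R]_(y in `[x0, (x0 + k * h)%R])
    `|f y|%:E <= (k `^ lambda * (1 + A) * p * n)%:E)%E.
  move=> k1; have kh0 : 0 < k * h by rewrite mulr_gt0//; lra.
  have [q q0 Phiq] := Phi_fin x0 _ kh0.
  apply: (le_trans (intf _ _ _ kh0 q0 Phiq)).
  rewrite -EFinM lee_fin ler_wpM2r//.
  have := Phi_plus_dilate lambda w_weight A0 wA x0 h0 k1.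
  by rewrite Phip Phiq -EFinM lee_fin.
rewrite Phip inver gt_eqF// lee_pdivrMl//.
pose I := `[x0, x0 + 2 * h]%classic.
have mI : measurable I by exact: measurable_itv.
pose f1 := f \_ I.
have intI := intk 2 (ler1n _ 2).
have f1L1 : L1 f1.
  by apply: restrict_L1 => //; exact: (le_lt_trans intI (ltry _)).
have Df1 : D f1 by exact: D_L1.
have Df : D f by exact: D_morrey.
(* The far part is built from f and f1 by the operations that D is stable
   under, which puts it in D. *)
pose g := (f \+ (fun y => -1 * f1 y)).
have Dg : D g by apply: (sublin_domD T_sublinear) => //; exact: (sublin_domZ T_sublinear).
have gE y : g y = if y \in I then 0 else f y.
  by rewrite /g /f1 /= patchE; case: ifP => _; rewrite mulN1r ?subrr ?subr0.
have fE : f = f1 \+ g by apply/funext => y; rewrite /g /=; ring.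
set M := C * (r ^+ 2 * (1 + A) * p * n / h / (1 - r / 2)).
have M0 : 0 <= M.
  rewrite /M !mulr_ge0 ?invr_ge0 ?exprn_ge0//; lra.
have Tg x : x \in `]x0, x0 + h[ -> (`|T g x| <= M%:E)%E.
  rewrite in_itv/= => /andP[x0x xh].
  apply: (le_trans (T_size _ Dg x)); rewrite /M EFinM.
  apply: lee_wpmul2l; first by rewrite lee_fin ltW.
  apply: (@tail_kernel_integral_le R f g x0 h x _ r) => //.
  - exact: (sublin_dom_measurable T_sublinear Dg).
  - by rewrite !mulr_ge0 ?exprn_ge0//; lra.
  - by rewrite r0.
  - by move=> y _; rewrite gE; case: ifP => // _; rewrite normr0.
  - by move=> y xy; rewrite gE ifT// inE /I/= in_itv/=; lra.
  move=> j; apply: (le_trans (intk _ _)); first by rewrite exprn_ege1// ler1n.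
  have -> : (2 ^+ j.+2) `^ lambda = r ^+ j.+2.
    by rewrite -powR_mulrn// powRAC powR_mulrn// ltW.
  by rewrite lee_fin 2!exprS le_eqVlt; apply/orP; left; apply/eqP; ring.
apply: (@le_trans _ _ (2%:E * weak_Lpow 1 setT (T f1) + (2 * M * (x0 + h - x0))%:E)%E).
  apply: (@weak_Lpow1_le_add R (T f) (T f1) (T g)) => //.
  - by rewrite ltrDl.
  - exact: (sublin_measurable T_sublinear Df).
  - exact: (sublin_measurable T_sublinear Df1).
  - by have := sublin_subadditive T_sublinear Df1 Dg; rewrite -fE.
apply: (@le_trans _ _ (2%:E * (B%:E * (r * (1 + A) * p * n)%:E) + (2 * M * h)%:E)%E).
  apply: leeD; last by rewrite addrAC subrr add0r.
  apply: lee_wpmul2l => //; rewrite -weak_Lnorm1E.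
  apply: (le_trans (TB _ f1L1)); apply: lee_wpmul2l; first by rewrite lee_fin ltW.
  by rewrite L1_norm_restrict.
rewrite -!EFinM -EFinD lee_fin le_eqVlt; apply/orP; left; apply/eqP.
by rewrite /K /M; field; rewrite !gt_eqF//; lra.
Qed.
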